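(* Let $n\ge 2$, let $\mathcal{X}=\{x_i\}_{i=1}^m$ be a frame for $\mathbb{R}^n$, and let $\tilde{\theta}_{\mathcal{X}}$ be the reduced diagram matrix of $\mathcal{X}$, with columns $\tilde{x}_1,\dots,\tilde{x}_m$ (the reduced diagram vectors). Then the following are equivalent. (1) $\mathcal{X}$ is scalable. (2) There is a non-negative, non-zero vector $c=(c_1,\dots,c_m)$ such that $c$ is orthogonal to every row of $\tilde{\theta}_{\mathcal{X}}$. (3) There is a non-negative, non-zero vector $c=(c_1,\dots,c_m)$ in the null space of $\tilde{\theta}_{\mathcal{X}}$. (4) There is a non-negative, non-zero vector $c=(c_1,\dots,c_m)$ such that $\sum_{i=1}^m c_i\tilde{x}_i=0$, i.e., $0$ can be represented as a linear combination of the reduced diagram vectors $\tilde{x}_i$ with non-negative coefficients (given by the non-zero vector $c$). (5) There is a non-negative, non-zero vector $c=(c_1,\dots,c_m)$ in the null space of the Gram matrix $\tilde{\theta}_{\mathcal{X}}^*\tilde{\theta}_{\mathcal{X}}$ of $\tilde{\theta}_{\mathcal{X}}$.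
   Context: A sequence $\{x_i\}_{i=1}^m\subset\mathbb{R}^n$ is a frame for $\mathbb{R}^n$ if there are $0<A\le B<\infty$ with $A\|x\|^2\le\sum_{i=1}^m|\langle x,x_i\rangle|^2\le B\|x\|^2$ for all $x\in\mathbb{R}^n$; it is tight if one can take $A=B$. A frame $\{x_i\}_{i=1}^m$ is scalable if there exist non-negative constants $a_1,\dots,a_m$ such that $\{a_ix_i\}_{i=1}^m$ is a tight frame. A vector is non-negative if all its entries are $\ge 0$. For $x=(x(1),\dots,x(n))\in\mathbb{R}^n$ with $n\ge2$, the reduced diagram vector $\tilde{x}\in\mathbb{R}^{(n-1)(n+2)/2}$ is $\frac{1}{\sqrt{n-1}}$ times the vector whose first $n-1$ entries are $x(1)^2-x(j)^2$, $j=2,\dots,n$, and whose remaining $n(n-1)/2$ entries are $\sqrt{2n}\,x(i)x(j)$, $1\le i<j\le n$. The reduced diagram matrix $\tilde{\theta}_{\mathcal{X}}$ is the $\frac{(n-1)(n+2)}{2}\times m$ matrix whose $i$-th column is $\tilde{x}_i$.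
   Formalization: All frame vectors are assumed non-zero; without this the claim fails, e.g. for n=2 and the frame (e1, e1+e2, 0), where c=(0,0,1) satisfies (2)–(5) but the frame is not scalable. *)

(* Defs.v *)
From HB Require Import structures.
From mathcomp Require Import all_boot all_order all_algebra.
From mathcomp Require Import reals zify.

Set Implicit Arguments.
Unset Strict Implicit.
Unset Printing Implicit Defensive.

Import Order.TTheory GRing.Theory Num.Theory.
Local Open Scope ring_scope.

Section Frames.
Variable R : realType.

Definition inner n (x y : 'cV[R]_n) : R := \sum_(i < n) x i 0 * y i 0.

Definition enorm n (x : 'cV[R]_n) : R := Num.sqrt (inner x x).

Definition frame_bounds n m (X : 'I_m -> 'cV[R]_n) (A B : R) : Prop :=
  [/\ 0 < A, A <= B &
    forall x : 'cV[R]_n,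
      A * enorm x ^+ 2 <= \sum_(i < m) `|inner x (X i)| ^+ 2 <= B * enorm x ^+ 2].

Definition is_frame n m (X : 'I_m -> 'cV[R]_n) : Prop :=
  exists A B : R, frame_bounds X A B.

Definition is_tight_frame n m (X : 'I_m -> 'cV[R]_n) : Prop :=
  exists A : R, frame_bounds X A A.

Definition scalable_frame n m (X : 'I_m -> 'cV[R]_n) : Prop :=
  exists a : 'I_m -> R,
    (forall i, 0 <= a i) /\ is_tight_frame (fun i => a i *: X i).

Definition nonneg_vec m (c : 'cV[R]_m) : Prop := forall i, 0 <= c i 0.

(* Indices start at 0.  In the first list [i] takes only the value 0 (filtering
   the enumeration avoids needing an element of ['I_n] when [n] is a variable);
   the pairs [i < j] of the second list are in lexicographic order. *)
Definition reduced_diagram_entries n (x : 'cV[R]_n) : seq R :=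
  [seq x i 0 ^+ 2 - x j 0 ^+ 2 |
        i <- [seq i : 'I_n <- enum 'I_n | (i == 0 :> nat)%N],
        j <- [seq j : 'I_n <- enum 'I_n | (0 < j)%N]]
  ++ [seq Num.sqrt (2 * n)%:R * (x i 0 * x j 0) |
        i <- enum 'I_n, j <- [seq j : 'I_n <- enum 'I_n | (i < j)%N]].

(* [nth] below never falls back on its default value, nor drops an entry. *)
Lemma size_reduced_diagram_entries n (x : 'cV[R]_n) :
  size (reduced_diagram_entries x) = (n.-1 * n.+2)./2.
Proof.
have cgt k : size [seq j : 'I_n <- enum 'I_n | (k < j)%N] = (n - k.+1)%N.
  rewrite size_filter -(count_map val (fun j => k < j)%N) val_enum_ord.
  elim: n {x} => [|n IHn]; first by rewrite sub0n.
  rewrite -[in iota _ _]addn1 iotaD count_cat IHn /= add0n addn0.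
  rewrite subSS; case: ltnP => [kn|nk] /=; first by rewrite addn1 -subSn.
  by rewrite addn0 (eqP nk) (eqP (leqW nk : (n - k.+1)%N == 0)).
have ceq : size [seq i : 'I_n <- enum 'I_n | (i == 0 :> nat)%N] = (0 < n)%N.
  rewrite size_filter -(count_map val (fun i => i == 0%N)) val_enum_ord.
  by rewrite count_uniq_mem ?iota_uniq// mem_iota.
rewrite /reduced_diagram_entries size_cat !size_allpairs_dep !sumnE !big_map.
rewrite big_const_seq count_predT ceq iter_addn_0 cgt.
under eq_bigr => i _ do rewrite cgt.
rewrite -enumT big_enum /= (reindex_inj rev_ord_inj) /=.
under eq_bigr => i _ do rewrite subnSK // subKn 1?ltnW //.
case: n {x cgt ceq} => [|n]; first by rewrite big_ord0.
rewrite muln1 subn1 /= -(big_mkord xpredT (fun i => i)) bin2_sum bin2 /=.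
have -> : (n * n.+3 = n.*2 + n.+1 * n)%N by lia.
by rewrite halfD odd_double /= add0n doubleK.
Qed.

Definition reduced_diagram_vector n (x : 'cV[R]_n) :
    'cV[R]_((n.-1 * n.+2)./2) :=
  (Num.sqrt n.-1%:R)^-1 *: \col_k nth 0 (reduced_diagram_entries x) k.

Definition reduced_diagram_matrix n m (X : 'I_m -> 'cV[R]_n) :
    'M[R]_((n.-1 * n.+2)./2, m) :=
  \matrix_(k, i) reduced_diagram_vector (X i) k 0.

End Frames.

(* Main.v *)
Require Import Defs.
From HB Require Import structures.
From mathcomp Require Import all_boot all_order all_algebra.
From mathcomp Require Import reals.

Import Order.TTheory GRing.Theory Num.Theory.
Local Open Scope ring_scope.

(** With weights [c = a^2], tightness of [{a_i x_i}] says that the quadratic form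
    of the frame operator [S = \sum_i c_i x_i x_i^T] is a multiple of the squared
    norm, that is, by polarization, that [S] is a scalar matrix. Up to nonzero
    factors, the entries of [\sum_i c_i \tilde x_i] are the differences
    [S_00 - S_jj] and the entries [S_ij] with [i < j], so they all vanish
    exactly when [S] is scalar. The scalar is positive because [n S_00] is the
    trace of [S], namely [\sum_i c_i |x_i|^2], and no [x_i] is zero. *)

Section ScalableFrames.
Set Implicit Arguments.
Unset Strict Implicit.
Context {R : realType}.
Implicit Types n m : nat.

Lemma addmxE m n (A B : 'M[R]_(m, n)) i j : (A + B) i j = A i j + B i j.
Proof. by rewrite mxE. Qed.

Lemma scalemxE m n a (A : 'M[R]_(m, n)) i j : (a *: A) i j = a * A i j.
Proof. by rewrite mxE. Qed.

Lemma innerE n (x y : 'cV[R]_n) : inner x y = (x^T *m y) 0 0.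
Proof. by rewrite mxE; apply: eq_bigr => i _; rewrite mxE. Qed.

Lemma inner_trE n (x y : 'cV[R]_n) : (x^T *m y) = (inner x y)%:M.
Proof. by rewrite innerE -mx11_scalar. Qed.

Lemma innerC n (x y : 'cV[R]_n) : inner x y = inner y x.
Proof. by apply: eq_bigr => i _; rewrite mulrC. Qed.

Lemma innerZr n a (x y : 'cV[R]_n) : inner x (a *: y) = a * inner x y.
Proof. by rewrite !innerE -scalemxAr mxE. Qed.

Lemma inner_ge0 n (x : 'cV[R]_n) : 0 <= inner x x.
Proof. by apply: sumr_ge0 => i _; rewrite -expr2 sqr_ge0. Qed.

Lemma inner_eq0 n (x : 'cV[R]_n) : (inner x x == 0) = (x == 0).
Proof.
apply/eqP/eqP => [/eqP|->]; last by rewrite innerE mulmx0 mxE.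
rewrite psumr_eq0 => [/allP x0|i _]; last by rewrite -expr2 sqr_ge0.
apply/colP => i; apply/eqP; rewrite mxE.
by have := x0 i (mem_index_enum i); rewrite /= mulf_eq0 orbb.
Qed.

Lemma sqr_enorm n (x : 'cV[R]_n) : enorm x ^+ 2 = inner x x.
Proof. by rewrite /enorm sqr_sqrtr // inner_ge0. Qed.

Definition frame_operator n m (c : 'I_m -> R) (X : 'I_m -> 'cV[R]_n) : 'M[R]_n :=
  \sum_(i < m) c i *: (X i *m (X i)^T).

Lemma frame_operatorE n m c (X : 'I_m -> 'cV[R]_n) j k :
  frame_operator c X j k = \sum_(i < m) c i * (X i j 0 * X i k 0).
Proof.
rewrite summxE; apply: eq_bigr => i _.
by rewrite !mxE big_ord1 !mxE.
Qed.

Lemma inner_frame_operator n m c (X : 'I_m -> 'cV[R]_n) (x : 'cV[R]_n) :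
  inner x (frame_operator c X *m x) = \sum_(i < m) c i * inner x (X i) ^+ 2.
Proof.
rewrite innerE mulmx_suml mulmx_sumr summxE; apply: eq_bigr => i _.
rewrite -scalemxAl -scalemxAr mxE -(mulmxA (X i)) (mulmxA x^T) !inner_trE.
by rewrite -scalar_mxM mxE eqxx mulr1n (innerC (X i)) expr2.
Qed.

Lemma mxtrace_frame_operator n m c (X : 'I_m -> 'cV[R]_n) :
  \tr (frame_operator c X) = \sum_(i < m) c i * inner (X i) (X i).
Proof.
rewrite raddf_sum; apply: eq_bigr => i _ /=.
by rewrite mxtraceZ mxtrace_mulC inner_trE mxtrace_scalar mulr1n.
Qed.

Lemma frame_operator_sym n m c (X : 'I_m -> 'cV[R]_n) :
  (frame_operator c X)^T = frame_operator c X.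
Proof.
by rewrite /frame_operator raddf_sum; apply: eq_bigr => i _ /=;
  rewrite linearZ /= trmx_mul trmxK.
Qed.

Lemma sym_quadratic_scalar n (S : 'M[R]_n) A : S^T = S ->
  (forall x : 'cV[R]_n, inner x (S *m x) = A * inner x x) -> S = A%:M.
Proof.
move=> symS; rewrite -[S](subrK A%:M); set T := S - _ => qS.
have symT : T^T = T by rewrite /T raddfB /= symS tr_scalar_mx.
have qT (x : 'cV[R]_n) : (x^T *m T *m x) 0 0 = 0.
  have := qS x; rewrite mulmxDl mul_scalar_mx !innerE mulmxDr mxE.
  rewrite -scalemxAr [X in _ + X = _]mxE mulmxA.
  by move/(canRL (addrK _)); rewrite subrr.
clearbody T => {qS}.
have dT i j : ((delta_mx i 0 : 'cV[R]_n)^T *m T *m (delta_mx j 0 : 'cV_n)) 0 0 = T i j.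
  by rewrite trmx_delta -rowE -colE !mxE.
suff -> : T = 0 by rewrite add0r.
apply/matrixP => i j; rewrite [RHS]mxE.
have := qT (delta_mx i 0 + delta_mx j 0).
rewrite [(_ + _)^T]linearD /= !mulmxDl !mulmxDr !addmxE !qT !dT add0r addr0.
have -> : T j i = T i j by rewrite -[in LHS]symT mxE.
rewrite -mulr2n => /eqP.
by rewrite mulrn_eq0 => /eqP.
Qed.

Lemma tight_frame_operatorP n m a (X : 'I_m -> 'cV[R]_n) :
  is_tight_frame (fun i => a i *: X i) <->
  exists2 A, 0 < A & frame_operator (fun i => a i ^+ 2) X = A%:M.
Proof.
have sumE x : \sum_(i < m) `|inner x (a i *: X i)| ^+ 2 =
    inner x (frame_operator (fun i => a i ^+ 2) X *m x).
  rewrite inner_frame_operator; apply: eq_bigr => i _.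
  by rewrite real_normK ?num_real // innerZr exprMn.
split=> -[A].
- case=> A0 _ AX; exists A => //; apply: sym_quadratic_scalar.
    exact: frame_operator_sym.
  by move=> x; apply/eqP; rewrite eq_le andbC -sumE -sqr_enorm AX.
- move=> A0 SA; exists A; split=> // x.
  by rewrite sumE SA mul_scalar_mx innerZr sqr_enorm lexx.
Qed.

(* The position [inl (0, j)] holds [x(0)^2 - x(j)^2], and [inr (i, j)] the
   product [x(i) x(j)]. *)
Definition diagram_index n : seq ('I_n * 'I_n + 'I_n * 'I_n) :=
  [seq inl (i, j) | i : 'I_n <- [seq i : 'I_n <- enum 'I_n | (i == 0 :> nat)%N],
                    j : 'I_n <- [seq j : 'I_n <- enum 'I_n | (0 < j)%N]]
  ++ [seq inr (i, j) | i : 'I_n <- enum 'I_n,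
                       j : 'I_n <- [seq j : 'I_n <- enum 'I_n | (i < j)%N]].

Definition diagram_entry n (S : 'M[R]_n) (t : 'I_n * 'I_n + 'I_n * 'I_n) : R :=
  match t with
  | inl (i, j) => S i i - S j j
  | inr (i, j) => Num.sqrt (2 * n)%:R * S i j
  end.

Lemma reduced_diagram_entriesE n (x : 'cV[R]_n) :
  reduced_diagram_entries x = map (diagram_entry (x *m x^T)) (diagram_index n).
Proof.
rewrite map_cat !map_allpairs; congr (_ ++ _);
  apply: eq_allpairs => i j /=; by rewrite !mxE !big_ord1 !mxE ?expr2.
Qed.

Lemma diagram_entry_frame_operator n m c (X : 'I_m -> 'cV[R]_n) t :
  diagram_entry (frame_operator c X) t =
  \sum_(i < m) c i * diagram_entry (X i *m (X i)^T) t.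
Proof.
case: t => -[j k] /=.
- rewrite !summxE -sumrB; apply: eq_bigr => i _.
  by rewrite !scalemxE mulrBr.
- rewrite summxE mulr_sumr; apply: eq_bigr => i _.
  by rewrite !scalemxE mulrCA.
Qed.

Lemma mem_diagram_indexl n (i j : 'I_n) :
  (inl (i, j) \in diagram_index n) = (i == 0 :> nat)%N && (0 < j)%N.
Proof.
rewrite mem_cat; apply/orP/andP => [[]|[i0 j0]].
- case/allpairsPdep => i' [j' []]; rewrite !mem_filter.
  by case/andP=> i0 _ /andP[j0 _] [-> ->].
- by case/allpairsPdep => i' [j' []].
- left; apply/allpairsPdep; exists i, j.
  by rewrite mem_filter i0 mem_enum mem_filter j0 mem_enum.
Qed.

Lemma mem_diagram_indexr n (i j : 'I_n) :
  (inr (i, j) \in diagram_index n) = (i < j)%N.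
Proof.
rewrite mem_cat; apply/orP/idP => [[]|ij].
- by case/allpairsPdep => i' [j' []].
- case/allpairsPdep => i' [j' []]; rewrite !mem_filter.
  by move=> _ /andP[ij _] [-> ->].
- right; apply/allpairsPdep; exists i, j.
  by rewrite mem_enum mem_filter ij mem_enum.
Qed.

Lemma diagram_entry_eq0P n (S : 'M[R]_n) : (0 < n)%N -> S^T = S ->
  {in diagram_index n, forall t, diagram_entry S t = 0} <-> is_scalar_mx S.
Proof.
case: n S => // n S _ symS; split=> [S0|/is_scalar_mxP[a ->] [] [i j]].
- apply/is_scalar_mxP; exists (S 0 0).
  have Sup (i j : 'I_n.+1) : (i < j)%N -> S i j = 0.
    move=> ij; have /S0/= /eqP : inr (i, j) \in diagram_index n.+1.
      by rewrite mem_diagram_indexr.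
    by rewrite mulf_eq0 sqrtr_eq0 lern0 => /eqP.
  apply/matrixP => i j; rewrite mxE -val_eqE.
  case: ltngtP => [/Sup //|ji|/val_inj <-]; first by rewrite -symS mxE Sup.
  have [i0|i0] := posnP i; first by rewrite (_ : i = 0) //; apply: val_inj.
  apply/esym/eqP; rewrite -subr_eq0; apply/eqP.
  by apply: (S0 (inl (0, i))); rewrite mem_diagram_indexl.
- by rewrite /= !mxE !eqxx subrr.
- rewrite mem_diagram_indexr /= mxE -val_eqE.
  by case: ltngtP; rewrite // mulr0.
Qed.

Lemma reduced_diagram_matrix_kerP n m (c : 'cV[R]_m) (X : 'I_m -> 'cV[R]_n) :
  (1 < n)%N ->
  reduced_diagram_matrix X *m c = 0 <->
  is_scalar_mx (frame_operator (fun i => c i 0) X).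
Proof.
move=> n1; set S := frame_operator _ _.
have sz : size (diagram_index n) = (n.-1 * n.+2)./2.
  rewrite -(size_reduced_diagram_entries (0 : 'cV[R]_n)).
  by rewrite reduced_diagram_entriesE size_map.
have n0 : (Num.sqrt n.-1%:R)^-1 != 0 :> R.
  by rewrite invr_eq0 sqrtr_eq0 lern0 -lt0n; case: n n1 {X S sz} => [|[]].
have thetaE t0 k : (reduced_diagram_matrix X *m c) k 0 =
    (Num.sqrt n.-1%:R)^-1 * diagram_entry S (nth t0 (diagram_index n) k).
  rewrite diagram_entry_frame_operator mulr_sumr mxE; apply: eq_bigr => i _.
  rewrite !mxE reduced_diagram_entriesE (nth_map t0) ?sz //.
  by rewrite -mulrA; congr (_ * _); rewrite mulrC.
rewrite -diagram_entry_eq0P; [|exact: ltnW|exact: frame_operator_sym].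
split=> [ker t tI|S0].
- have tk : (index t (diagram_index n) < (n.-1 * n.+2)./2)%N.
    by rewrite -sz index_mem.
  have /eqP := thetaE t (Ordinal tk).
  by rewrite ker mxE nth_index // eq_sym mulf_eq0 (negPf n0) => /eqP.
- pose o := Ordinal n1; apply/colP => k; rewrite (thetaE (inl (o, o))) S0 ?mulr0 ?mxE //.
  by rewrite mem_nth // sz.
Qed.

Lemma scalable_frameP n m (X : 'I_m -> 'cV[R]_n) : (1 < n)%N ->
  (forall i, X i != 0) ->
  scalable_frame X <->
  exists c : 'cV[R]_m,
    [/\ nonneg_vec c, c != 0 & reduced_diagram_matrix X *m c = 0].
Proof.
move=> n1 X0; split=> [[a [a0 /tight_frame_operatorP[A A0 SA]]]|[c [c0 cn0]]].
- pose c : 'cV[R]_m := \col_i (a i ^+ 2).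
  have SE : frame_operator (fun i => c i 0) X = A%:M.
    by rewrite -SA; apply: eq_bigr => i _; rewrite mxE.
  exists c; split.
  + by move=> i; rewrite mxE sqr_ge0.
  + apply/eqP => c0; have := congr1 (@mxtrace R n) SE.
    rewrite mxtrace_frame_operator big1 => [/esym/eqP|i _].
      by rewrite mxtrace_scalar mulrn_eq0 (gt_eqF A0) orbF eqn0Ngt ltnW.
    by rewrite c0 mxE mul0r.
  + by apply/reduced_diagram_matrix_kerP => //; rewrite SE scalar_mx_is_scalar.
- case/reduced_diagram_matrix_kerP/is_scalar_mxP => // A SA.
  exists (fun i => Num.sqrt (c i 0)); split=> [i|]; first exact: sqrtr_ge0.
  apply/tight_frame_operatorP; exists A; last first.
    by rewrite -SA; apply: eq_bigr => i _; rewrite sqr_sqrtr.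
  have cX i : 0 <= c i 0 * inner (X i) (X i) by rewrite mulr_ge0 ?inner_ge0.
  suff: 0 < \tr (A%:M : 'M[R]_n) by rewrite mxtrace_scalar pmulrn_lgt0 // ltnW.
  rewrite -SA mxtrace_frame_operator lt0r sumr_ge0 // andbT psumr_eq0 //.
  apply: contra cn0 => /allP cX0; apply/eqP/colP => i; apply/eqP; rewrite mxE.
  have := cX0 i (mem_index_enum i).
  by rewrite /= mulf_eq0 inner_eq0 (negPf (X0 i)) orbF.
Qed.

Lemma gram_ker n m (M : 'M[R]_(m, n)) (c : 'cV[R]_n) :
  M^T *m M *m c = 0 <-> M *m c = 0.
Proof.
split=> [Mc|Mc]; last by rewrite -mulmxA Mc mulmx0.
by apply/eqP; rewrite -inner_eq0 innerE trmx_mul -mulmxA (mulmxA M^T) Mc mulmx0 mxE.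
Qed.

Lemma inner_row_ker n m (M : 'M[R]_(m, n)) (c : 'cV[R]_n) :
  (forall k, inner (row k M)^T c = 0) <-> M *m c = 0.
Proof.
have E k : inner (row k M)^T c = (M *m c) k 0.
  by rewrite innerE trmxK -row_mul mxE.
split=> [Mc|Mc k]; last by rewrite E Mc mxE.
by apply/colP => k; rewrite -E Mc mxE.
Qed.

Lemma reduced_diagram_matrix_mul n m (X : 'I_m -> 'cV[R]_n) (c : 'cV[R]_m) :
  reduced_diagram_matrix X *m c =
  \sum_(i < m) c i 0 *: reduced_diagram_vector (X i).
Proof.
apply/colP => k; rewrite mxE summxE; apply: eq_bigr => i _.
by rewrite scalemxE mxE mulrC.
Qed.

End ScalableFrames.

Theorem theorem3p6 (R : realType) (n m : nat) (hn : (2 <= n)%N)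
    (X : 'I_m -> 'cV[R]_n) (hX : is_frame X) (hX0 : forall i, X i != 0) :
  let theta := reduced_diagram_matrix X in
  [<-> scalable_frame X;
       exists c : 'cV[R]_m, [/\ nonneg_vec c, c != 0 &
         forall k, inner (row k theta)^T c = 0];
       exists c : 'cV[R]_m, [/\ nonneg_vec c, c != 0 & theta *m c = 0];
       exists c : 'cV[R]_m, [/\ nonneg_vec c, c != 0 &
         \sum_(i < m) c i 0 *: reduced_diagram_vector (X i) = 0];
       exists c : 'cV[R]_m, [/\ nonneg_vec c, c != 0 &
         (theta^T *m theta) *m c = 0]].
Proof.
move=> theta; tfae.
- by case/scalable_frameP => // c [c0 cn0 /inner_row_ker]; exists c.
- by case=> c [c0 cn0 /inner_row_ker]; exists c.
- by case=> c [c0 cn0]; rewrite reduced_diagram_matrix_mul; exists c.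
- case=> c [c0 cn0]; rewrite -reduced_diagram_matrix_mul => /gram_ker.
  by exists c.
- by case=> c [c0 cn0 /gram_ker ker]; apply/scalable_frameP => //; exists c.
Qed.
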